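(* For every integer $n\geq 2$ and every permutation $\mathbf{a}$ of $[n]=\{1,\dots,n\}$, $\mathbf{a}$ contains a pair of twins of length at least $\tfrac{1}{8}n^{3/5}$.
   Context: A permutation of a finite set $\Sigma\subset\mathbb{N}$ is a sequence in which every element of $\Sigma$ appears exactly once; a subpermutation of a permutation is a subsequence of it. Two sequences $(a_1,\dots,a_L)$ and $(b_1,\dots,b_L)$ of distinct numbers are order-isomorphic if for all $i,j$: $a_i<a_j \iff b_i<b_j$. Two subpermutations of a permutation are called twins if they are order-isomorphic and disjoint (share no symbol); their length is their common number of entries. *)

(* Defs.v *)
From mathcomp Require Import all_boot.
Set Implicit Arguments. Unset Strict Implicit. Unset Printing Implicit Defensive.

Definition is_perm_of (n : nat) (a : seq nat) : Prop := perm_eq a (iota 1 n).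

Definition subperm (s a : seq nat) : Prop := subseq s a.

Definition order_iso (s t : seq nat) : Prop :=
  size s = size t /\
  forall i j, i < size s -> j < size s ->
    (nth 0 s i < nth 0 s j) = (nth 0 t i < nth 0 t j).

Definition twins (a s t : seq nat) : Prop :=
  [/\ subperm s a, subperm t a, order_iso s t & forall x, x \in s -> x \notin t].

(* Main.v *)
Require Import Defs.
From mathcomp Require Import all_boot zify ring.
Set Implicit Arguments. Unset Strict Implicit. Unset Printing Implicit Defensive.

(** Cut the values into [K] consecutive blocks of length [b] and scan the
    permutation from left to right.  Among the next [3 q^3 + 2 K + 1] entries,
    group the entries of each block into value-consecutive triples; at most two
    entries per block are left over, so there are more than [q^3] triples.  The
    first, second and third members order the triples by position in three ways,
    and (Beame, Blais, Huynh-Ngoc) two of these three orders share a subsequence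
    of length [q + 1], which gives twins whose i-th entries lie in the same block.
    Discard the blocks just used, i.e. at most [(q + 1) b] values, and go on:
    as different segments use different blocks, the concatenations are twins.
    For [n = p^5] take [b = 2 p^2] and [q = p / 2]; for [n < 7^5] twins of length
    about [sqrt n / 2], given by [b = K = sqrt n] and [q = 1], are enough. *)

(** * Chains, ranks and three linear orders *)

Fixpoint chain_to (T : finType) (R : rel T) k (i : T) : bool :=
  if k is k'.+1 then [exists j, R j i && chain_to R k' j] else true.

Lemma chain_toW (T : finType) (R : rel T) k i :
  chain_to R k.+1 i -> chain_to R k i.
Proof.
elim: k i => [|k IHk] i //.
case/existsP=> j /andP[Rji cj].
by apply/existsP; exists j; rewrite Rji /=; case: k IHk cj => // k IHk; exact: IHk.
Qed.

Lemma chain_to_path (T : finType) (R : rel T) k i : chain_to R k i ->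
  exists s, [/\ size s = k.+1, sorted R s & last i s = i].
Proof.
elim: k i => [|k IHk] i /=; first by exists [:: i].
case/existsP=> j /andP[Rji /IHk [s [ss sR ls]]].
case: s ss sR ls => // x s ss sR ls.
exists (rcons (x :: s) i); split; first by rewrite size_rcons ss.
- by rewrite /= rcons_path; move: sR ls => /= -> ->.
- by rewrite last_rcons.
Qed.

(* The rank of an element is the length of the longest chain ending there. *)
Lemma chain_or_rank (T : finType) (R : rel T) q :
  (exists s, size s = q.+1 /\ sorted R s)
  \/ (exists h : T -> 'I_q, forall i j, R i j -> h i < h j).
Proof.
have [/existsP[i /chain_to_path [s [ss sR _]]] | noq] :=
  boolP [exists i, chain_to R q i]; first by left; exists s.
right; case: q noq => [|q] noq.
  (* For [q = 0] a single element is already a chain of length [q.+1], so [T] is empty. *)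
  suff T0 : forall i : T, False by exists (fun i => False_rect _ (T0 i)) => i.
  by move=> i; case/existsP: noq; exists i.
exists (fun i => [arg max_(k > ord0 | chain_to R (k : 'I_q.+1) i) k]).
move=> i j Rij; case: arg_maxnP => // k ci _; case: arg_maxnP => // l cj lmax.
have cSj : chain_to R k.+1 j by apply/existsP; exists i; rewrite Rij.
have ltkq : k.+1 < q.+1.
  rewrite ltn_neqAle ltn_ord andbT; apply: contraNneq noq => eqk.
  by apply/existsP; exists j; rewrite -eqk.
by have := lmax (Ordinal ltkq) cSj.
Qed.

Definition agree (T : Type) (u v : T -> nat) : rel T :=
  fun i j => (u i < u j) && (v i < v j).

(** If no two of the orders share such a chain, the ranks for the three pairs of orders embed [T]
    into a cube of side [q]. *)
Lemma common_chain (T : finType) (p : 'I_3 -> T -> nat) q :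
  (forall k, injective (p k)) -> q ^ 3 < #|T| ->
  exists k l s, [/\ k != l, size s = q.+1 & sorted (agree (p k) (p l)) s].
Proof.
move=> pI ltqT; pose o0 : 'I_3 := inord 0; pose o1 : 'I_3 := inord 1.
pose o2 : 'I_3 := inord 2.
have neq k l : k < 3 -> l < 3 -> k != l -> inord k != inord l :> 'I_3.
  by move=> hk hl; apply: contraNneq => /(congr1 val) /=; rewrite !inordK // => ->.
case: (chain_or_rank (agree (p o0) (p o1)) q) => [[s [ss sR]]|[h01 h01P]].
  by exists o0, o1, s; split=> //; apply: neq.
case: (chain_or_rank (agree (p o0) (p o2)) q) => [[s [ss sR]]|[h02 h02P]].
  by exists o0, o2, s; split=> //; apply: neq.
case: (chain_or_rank (agree (p o1) (p o2)) q) => [[s [ss sR]]|[h12 h12P]].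
  by exists o1, o2, s; split=> //; apply: neq.
pose h i := (h01 i, h02 i, h12 i).
suff /card_in_imset hI : {in [set: T] &, injective h}.
  have := max_card [in h @: [set: T]].
  by rewrite hI cardsT !card_prod !card_ord leqNgt -mulnA -[q * (q * q)]/(q ^ 3) ltqT.
(* Of three linear orders two agree on any pair, so that some rank differs. *)
move=> i j _ _ [e01 e02 e12]; apply/eqP/negPn/negP => neij.
have neqp k : p k i != p k j by rewrite (inj_eq (pI k)).
have := neqp o0; have := neqp o1; have := neqp o2; rewrite !neq_ltn.
have := h01P i j; have := h02P i j; have := h12P i j.
have := h01P j i; have := h02P j i; have := h12P j i.
rewrite e01 e02 e12 !ltnn /agree.
by do 6 case: (p _ _ < p _ _) => //=; move=> *; intuition.
Qed.

(** * Twins inside one segment *)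

(** Greedy scan, with [k] a lower bound for the blocks still present: three leading entries of one
    block form a triple; otherwise the one or two leading entries of the first block are dropped and
    [k] moves past that block, which pays for them in [2 * (K - k)]. *)
Lemma grouped_triples (f : nat -> nat) K k w :
  {homo f : u v / u <= v} -> sorted leq w -> all (fun v => k <= f v < K) w ->
  exists e T,
    [/\ subseq e w, size e = 3 * T, size w <= 3 * T + 2 * (K - k)
      & forall i j, i < T -> j < 3 -> f (nth 0 e (3 * i + j)) = f (nth 0 e (3 * i))].
Proof.
move=> fM; have [m] := ubnP (size w); elim: m w k => // m IHm w k ltm sw fw.
case: w ltm sw fw => [|x [|y [|z w]]] /=.
- by exists [::], 0.
- by move=> _ _; rewrite andbT => fx; exists [::], 0; split=> //=; lia.
- by move=> _ _ /and3P[fx _ _]; exists [::], 0; split=> //=; lia.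
move=> ltm /and3P[xy yz sw] /and4P[fx fy fz fw].
have pw := sw; rewrite (path_sortedE leq_trans) in pw; case/andP: pw => zw sw'.
have [fxz | nfxz] := eqVneq (f x) (f z).
  have [|||e [T [esw se leT ef]]] := IHm w k; [lia|by []|by []|].
  exists [:: x, y, z & e], T.+1; split.
  - by rewrite /= !eqxx.
  - by rewrite /= se; lia.
  - lia.
  move=> [|i] j iT j3.
    have fxy : f y = f x by have := fM _ _ xy; have := fM _ _ yz; lia.
    by case: j j3 => [|[|[|]]].
  by rewrite !(mulnS 3 i) -addnA; apply: ef.
have [fxy | nfxy] := eqVneq (f x) (f y).
  have [|||e [T [esw se leT ef]]] := IHm (z :: w) (f x).+1.
  - by rewrite /=; lia.
  - by [].
  - have lexz := leq_trans (fM _ _ xy) (fM _ _ yz).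
    have ltxz : f x < f z by rewrite ltn_neqAle nfxz.
    rewrite /= ltxz; apply/andP; split; first by case/andP: fz.
    apply/allP=> v wv; have := allP fw _ wv; have := fM _ _ (allP zw _ wv); lia.
  exists e, T; split=> //; last by rewrite /= in leT; lia.
  exact: subseq_trans esw (suffix_subseq [:: x; y] _).
have [|||e [T [esw se leT ef]]] := IHm [:: y, z & w] (f x).+1.
- by rewrite /=; lia.
- by rewrite /= yz.
- have ltxy : f x < f y by rewrite ltn_neqAle nfxy fM.
  rewrite /= ltxy; have := fM _ _ yz => yz'.
  apply/and3P; split; [by case/andP: fy|lia|].
  apply/allP=> v wv; have := allP fw _ wv; have := fM _ _ (allP zw _ wv); lia.
exists e, T; split=> //; last by rewrite /= in leT; lia.
exact: subseq_trans esw (suffix_subseq [:: x] _).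
Qed.

(** [J] filtered by membership in [s] has the members of [s] and is sorted in the same strict order,
    so it equals [s]. *)
Lemma index_sorted_subseq (T : eqType) (J s : seq T) : uniq J ->
  {subset s <= J} -> sorted (relpre (index^~ J) ltn) s -> subseq s J.
Proof.
move=> uJ sJ ss; apply/subseq_uniqP=> //.
apply: (@irr_sorted_eq _ (relpre (index^~ J) ltn)) => //.
- by move=> y x z /=; apply: ltn_trans.
- by move=> x /=; rewrite ltnn.
- apply: sorted_filter; first by move=> y x z /=; apply: ltn_trans.
  case EJ: {2}J => [|x0 J'] //; rewrite -EJ; apply/(sortedP x0) => i ltiJ.
  by have ltiJ' := ltnW ltiJ; rewrite /= !index_uniq.
by move=> x; rewrite mem_filter; case sx : (x \in s) => //=; rewrite sJ.
Qed.

(** Equal block sequences are what allows twins of different segments to be concatenated. *)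
Definition fibred_twins (f : nat -> nat) (a s t : seq nat) : Prop :=
  twins a s t /\ map f s = map f t.

Lemma segment_twins f K q J : {homo f : u v / u <= v} -> uniq J ->
  all (fun v => f v < K) J -> 3 * q ^ 3 + 2 * K < size J ->
  exists s t, fibred_twins f J s t /\ size s = q.+1.
Proof.
move=> fM uJ fK ltJ.
have [||e [T [esw se leT ef]]] := @grouped_triples f K 0 (sort leq J) fM.
- exact: (sort_sorted leq_total).
- by rewrite all_sort.
have se_lt : sorted ltn e.
  apply: (subseq_sorted ltn_trans esw); rewrite ltn_sorted_uniq_leq sort_uniq uJ.
  exact: (sort_sorted leq_total).
have ue : uniq e by apply: (sorted_uniq ltn_trans ltnn).
pose c (k : 'I_3) (i : 'I_T) := nth 0 e (3 * i + k).
have szc (k : 'I_3) (i : 'I_T) : 3 * i + k < size e.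
  by have := ltn_ord i; have := ltn_ord k; rewrite se; lia.
have cJ k i : c k i \in J.
  by rewrite -(mem_sort leq); apply: (mem_subseq esw); apply: mem_nth.
(* Triples are consecutive in [e], so values compare as triple numbers do, whichever member is
   taken; this makes the images of [h] under [c k] and [c l] order-isomorphic. *)
have c_lt k i j : (c k i < c k j) = (i < j).
  have mono (i' j' : 'I_T) : i' < j' -> c k i' < c k j'.
    by move=> ltij; apply: (sorted_ltn_nth ltn_trans) => //; rewrite ?inE ?szc //; lia.
  by case: (ltngtP i j) => [/mono | /mono | /val_inj ->]; lia.
have c_inj k l i j : c k i = c l j -> k = l /\ i = j.
  move/eqP; rewrite nth_uniq // => /eqP eqkl.
  by have := ltn_ord k; have := ltn_ord l; split; apply: val_inj => /=; lia.
have fc k l i : f (c k i) = f (c l i) by rewrite /c !ef.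
have [||k [l [h [nkl sh hs]]]] := @common_chain _ (fun k i => index (c k i) J) q.
- move=> k i j /= eqi; have [] // := c_inj k k i j.
  by rewrite -(nth_index 0 (cJ k i)) eqi nth_index.
- rewrite size_sort subn0 in leT.
  rewrite card_ord -(ltn_pmul2l (isT : 0 < 3)) -(ltn_add2r (2 * K)).
  exact: leq_trans ltJ leT.
have subJ m : sorted (agree (fun i => index (c m i) J) (fun i => index (c m i) J)) h ->
    subseq (map (c m) h) J.
  move=> hm; apply: index_sorted_subseq => //.
    by move=> _ /mapP[i _ ->].
  by rewrite sorted_map; apply: sub_sorted hm => i j /= /andP[].
exists (map (c k) h), (map (c l) h); split; last by rewrite size_map.
split; last by rewrite -!map_comp; apply: eq_map => i /=; apply: fc.
split.
- by apply: subJ; apply: sub_sorted hs => i j /andP[*]; apply/andP.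
- by apply: subJ; apply: sub_sorted hs => i j /andP[*]; apply/andP.
- split; first by rewrite !size_map.
  rewrite size_map; case: h {sh hs subJ} => // i0 h i j lti ltj.
  by rewrite !(nth_map i0) // !c_lt.
move=> _ /mapP[i _ ->]; apply/mapP=> -[j _ /c_inj [eqkl _]].
by rewrite eqkl eqxx in nkl.
Qed.

(** * Concatenating the twins of successive segments *)

(** Entries of [s1] and [s2] lie in different blocks, so they compare as their blocks do, and these
    blocks are the same in [t1] and [t2]. *)
Lemma fibred_twins_cat f (a a1 a2 s1 t1 s2 t2 : seq nat) :
  {homo f : u v / u <= v} -> subseq (a1 ++ a2) a ->
  (forall u v, u \in s1 -> v \in a2 -> f u != f v) ->
  fibred_twins f a1 s1 t1 -> fibred_twins f a2 s2 t2 ->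
  fibred_twins f a (s1 ++ s2) (t1 ++ t2).
Proof.
move=> fM sub12 f12 [[sa1 ta1 [sz1 iso1] dis1] fst1] [[sa2 ta2 [sz2 iso2] dis2] fst2].
have f_lt u v : f u != f v -> (u < v) = (f u < f v).
  move=> nf; apply/idP/idP => [/ltnW /fM lef|]; first by rewrite ltn_neqAle nf.
  by rewrite !ltnNge; apply: contra; apply: fM.
have fs12 i j : i < size s1 -> j < size s2 -> f (nth 0 s1 i) != f (nth 0 s2 j).
  by move=> lti ltj; apply: f12; [|apply: (mem_subseq sa2)]; apply: mem_nth.
have nf1 i : i < size s1 -> f (nth 0 t1 i) = f (nth 0 s1 i).
  by move=> lti; rewrite -!(nth_map 0 0 f) -?sz1 // fst1.
have nf2 i : i < size s2 -> f (nth 0 t2 i) = f (nth 0 s2 i).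
  by move=> lti; rewrite -!(nth_map 0 0 f) -?sz2 // fst2.
split; last by rewrite !map_cat fst1 fst2.
split.
- by apply: subseq_trans sub12; apply: cat_subseq.
- by apply: subseq_trans sub12; apply: cat_subseq.
- split; first by rewrite !size_cat sz1 sz2.
  move=> i j; rewrite size_cat !nth_cat -sz1 => lti ltj.
  case: (ltnP i (size s1)) => hi; case: (ltnP j (size s1)) => hj.
  + exact: iso1.
  + have hj' : j - size s1 < size s2 by lia.
    by rewrite f_lt ?fs12 // [RHS]f_lt ?nf1 ?nf2 ?fs12.
  + have hi' : i - size s1 < size s2 by lia.
    by rewrite f_lt 1?eq_sym ?fs12 // [RHS]f_lt ?nf1 ?nf2 1?eq_sym ?fs12.
  + by apply: iso2; lia.
move=> x; rewrite !mem_cat negb_or => /orP[xs | xs].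
  rewrite dis1 //=; apply/negP => /(mem_subseq ta2) xa2.
  by have := f12 _ _ xs xa2; rewrite eqxx.
(* A symbol common to [s2] and [t1] would share its block with an entry of [s1]. *)
rewrite dis2 // andbT; apply/negP => /(map_f f); rewrite -fst1 => /mapP[y ys1 fxy].
by have := f12 _ _ ys1 (mem_subseq sa2 xs); rewrite fxy eqxx.
Qed.

Lemma count_mem_le (f : nat -> nat) b (r a : seq nat) :
  (forall k, count (fun v => f v == k) a <= b) ->
  count (fun v => f v \in r) a <= size r * b.
Proof.
move=> fb; elim: r => [|k r IHr] /=; first by rewrite (eq_count (a2 := pred0)) ?count_pred0.
rewrite mulSn; apply: leq_trans (leq_add (fb k) IHr).
by rewrite -count_predUI -[leqLHS]addn0 leq_add // sub_count // => v; rewrite inE.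
Qed.

(** Each round consumes a segment and then discards at most [q.+1 * b] entries; the last round need
    not discard, whence the extra [q.+1 * b] on the right. *)
Lemma iterated_twins f K b q m a : {homo f : u v / u <= v} -> uniq a ->
  all (fun v => f v < K) a -> (forall k, count (fun v => f v == k) a <= b) ->
  m * ((3 * q ^ 3 + 2 * K).+1 + q.+1 * b) <= size a + q.+1 * b ->
  exists s t, fibred_twins f a s t /\ size s = m * q.+1.
Proof.
move=> fM; set l := (_ + _).+1; elim: m a => [|m IHm] a ua fK fb lem.
  by exists [::], [::]; split=> //; split=> //; split=> //; apply: sub0seq.
have lel : l <= size a by move: lem; rewrite mulSn; lia.
have [|||s1 [t1 [tw1 sz1]]] := @segment_twins f K q (take l a) fM.
- exact: take_uniq.
- by apply/allP=> v /mem_take; apply: (allP fK).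
- by rewrite size_takel.
pose a' := [seq v <- drop l a | f v \notin map f s1].
have sub_a' : subseq a' (drop l a) by apply: filter_subseq.
have sub_aa' : subseq a' a by apply: subseq_trans sub_a' (drop_subseq _ _).
have [||||s2 [t2 [tw2 sz2]]] := IHm a'.
- exact: subseq_uniq ua.
- by apply/allP=> v /(mem_subseq sub_aa'); apply: (allP fK).
- by move=> k; apply: leq_trans (fb k); apply: leq_count_subseq.
- have sz_a' : count (fun v => f v \in map f s1) (drop l a) + size a' = size a - l.
    by rewrite size_filter count_predC size_drop.
  have used := leq_trans (leq_count_subseq _ (drop_subseq a l)) (count_mem_le (map f s1) fb).
  rewrite size_map sz1 in used.
  move: lel lem sz_a' used; rewrite mulSn.
  by move: (size a') (count _ _) (size a) (q.+1 * b) (m * _); lia.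
exists (s1 ++ s2), (t1 ++ t2); split; last by rewrite size_cat sz1 sz2 mulSn.
apply: fibred_twins_cat tw1 tw2 => //.
  by rewrite -[X in subseq _ X](cat_take_drop l a) cat_subseq.
move=> u v us1; rewrite mem_filter => /andP[nfv _].
by apply: contraNneq nfv => <-; apply: map_f.
Qed.

(** * Choice of parameters *)

Lemma perm_twins n a N b K q m : is_perm_of n a -> 0 < b -> N <= n -> N <= K * b ->
  m * ((3 * q ^ 3 + 2 * K).+1 + q.+1 * b) <= N + q.+1 * b ->
  exists s t, twins a s t /\ size s = m * q.+1.
Proof.
move=> pa b_gt0 leNn leNK lem.
pose a' := [seq v <- a | v <= N].
have pa' : perm_eq a' (iota 1 N).
  apply: perm_trans (perm_filter _ pa) _; rewrite -(subnKC leNn) iotaD filter_cat.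
  rewrite (@eq_in_filter _ _ predT) => [|v]; last by rewrite mem_iota ltnS => /andP[].
  rewrite filter_predT (@eq_in_filter _ _ pred0) => [|v]; last first.
    by rewrite mem_iota add1n ltnNge => /andP[/negbTE].
  by rewrite filter_pred0 cats0.
(* Values start at 1, so the shift by one gives every block at most [b] values. *)
pose f v := v.-1 %/ b.
have [|||k||s [t [[[ss tt iso dis] _] sz]]] := @iterated_twins f K b q m a'.
- by move=> u v leuv; apply: leq_div2r; lia.
- by rewrite (perm_uniq pa') iota_uniq.
- apply/allP=> v; rewrite (perm_mem pa') mem_iota => hv.
  by rewrite ltn_divLR //; lia.
- rewrite (permP pa') -size_filter -[leqRHS](size_iota (k * b).+1).
  apply: uniq_leq_size => [|v]; first by rewrite filter_uniq // iota_uniq.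
  rewrite mem_filter !mem_iota => /andP[/eqP <- hv].
  by have := divn_eq v.-1 b; have := ltn_pmod v.-1 b_gt0; rewrite /f; lia.
- by rewrite (perm_size pa') size_iota.
exists s, t; split=> //; split=> //.
- exact: subseq_trans ss (filter_subseq _ _).
- exact: subseq_trans tt (filter_subseq _ _).
Qed.

Lemma root_floor k n : 0 < k -> exists r, r ^ k <= n < r.+1 ^ k.
Proof.
move=> k_gt0; elim: n => [|n [r /andP[ler ltr]]]; first by exists 0; rewrite exp0n // exp1n.
have [lt|ge] := ltnP n.+1 (r.+1 ^ k); first by exists r; rewrite lt leqW.
by exists r.+1; rewrite ge (leq_ltn_trans ltr) // ltn_exp2r.
Qed.

Lemma perm_twins_max n a N b K q : is_perm_of n a -> 0 < b -> N <= n -> N <= K * b ->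
  exists m s t, [/\ twins a s t, size s = m * q.+1
    & N + q.+1 * b < m.+1 * ((3 * q ^ 3 + 2 * K).+1 + q.+1 * b)].
Proof.
move=> pa b_gt0 leNn leNK; set d := (_.+1 + q.+1 * b).
have [s [t [tw sz]]] :=
  @perm_twins n a N b K q ((N + q.+1 * b) %/ d) pa b_gt0 leNn leNK (leq_divM _ _).
by exists ((N + q.+1 * b) %/ d), s, t; split=> //; rewrite ltn_ceil.
Qed.

(** Each round costs [4 * r + 4] and yields two entries. *)
Lemma twins_square n a r : is_perm_of n a -> 5 <= r -> r ^ 2 <= n ->
  exists s t, [/\ twins a s t, 1 < size s & r <= 2 * size s + 3].
Proof.
move=> pa le5r lern.
have [||m [s [t [tw sz ltm]]]] := @perm_twins_max n a (r ^ 2) r r 1 pa _ lern; [lia|lia|].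
exists s, t; split=> //; rewrite sz; first by case: m sz ltm => [|m] _ ltm; nia.
by rewrite leqNgt; apply/negP => ltr; nia.
Qed.

(* In terms of [u], where [p = 2 u + 7] or [p = 2 u + 8], the difference of the two
   sides is a polynomial with positive coefficients. *)
Lemma fifth_power_bound p (q := p./2) : 7 <= p ->
  (p.+1 ^ 3 + 8 * q + 7) * (3 * q ^ 3 + 2 + p ^ 3 + q.+1 * (2 * p ^ 2))
    < 8 * q.+1 * (p ^ 5 + q.+1 * (2 * p ^ 2)).+1.
Proof.
move=> le7p; have := odd_double_half p; rewrite -/q; clearbody q.
case: (odd p) => /= eqp.
  have [u -> ->] : exists2 u, q = u + 3 & p = 2 * u + 7 by exists (q - 3); lia.
  have -> : 8 * (u + 3).+1 * ((2 * u + 7) ^ 5 + (u + 3).+1 * (2 * (2 * u + 7) ^ 2)).+1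
     = ((2 * u + 7).+1 ^ 3 + 8 * (u + 3) + 7) *
       (3 * (u + 3) ^ 3 + 2 + (2 * u + 7) ^ 3 + (u + 3).+1 * (2 * (2 * u + 7) ^ 2))
     + (104 * u ^ 6 + 2088 * u ^ 5 + 17216 * u ^ 4 + 74379 * u ^ 3
        + 176703 * u ^ 2 + 217097 * u + 106225).+1 by ring.
  by rewrite -[ltnLHS]addn0 ltn_add2l.
have [u -> ->] : exists2 u, q = u + 4 & p = 2 * u + 8 by exists (q - 4); lia.
have -> : 8 * (u + 4).+1 * ((2 * u + 8) ^ 5 + (u + 4).+1 * (2 * (2 * u + 8) ^ 2)).+1
   = ((2 * u + 8).+1 ^ 3 + 8 * (u + 4) + 7) *
     (3 * (u + 4) ^ 3 + 2 + (2 * u + 8) ^ 3 + (u + 4).+1 * (2 * (2 * u + 8) ^ 2))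
   + (104 * u ^ 6 + 2460 * u ^ 5 + 23942 * u ^ 4 + 122440 * u ^ 3
      + 345864 * u ^ 2 + 509100 * u + 302631).+1 by ring.
by rewrite -[ltnLHS]addn0 ltn_add2l.
Qed.

Lemma twins_fifth_power n a p : is_perm_of n a -> 7 <= p -> p ^ 5 <= n ->
  exists s t, twins a s t /\ p.+1 ^ 3 <= 8 * size s.
Proof.
move=> pa le7p lepn; set q := p./2; set K := uphalf (p ^ 3).
have [||m [s [t [tw sz ltm]]]] := @perm_twins_max n a (p ^ 5) (2 * p ^ 2) K q pa _ lepn.
- by rewrite muln_gt0 expn_gt0; lia.
- by rewrite (expnD p 3 2) mulnA leq_mul // /K; lia.
exists s, t; split=> //; rewrite sz.
have leK : 2 * K <= p ^ 3 + 1 by rewrite /K; lia.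
set d := _.+1 + q.+1 * _ in ltm.
have le_d : d <= 3 * q ^ 3 + 2 + p ^ 3 + q.+1 * (2 * p ^ 2) by rewrite /d leq_add2r; lia.
have key := fifth_power_bound le7p; rewrite -/q in key.
(* If [8 * (m * q.+1) < p.+1 ^ 3], then [8 * q.+1 * m.+1] is at most [p.+1 ^ 3 + 8 * q + 7], the
   first factor in [key]. *)
rewrite leqNgt; apply/negP => lt_p.
have := leq_trans key (leq_mul (leqnn (8 * q.+1)) ltm).
rewrite ltnNge => /negP; apply.
rewrite mulnA; apply: leq_mul le_d.
by move: lt_p; rewrite mulnS -mulnA (mulnC q.+1); move: (p.+1 ^ 3) (m * q.+1); lia.
Qed.

Lemma twins_nontrivial n a : 2 <= n -> is_perm_of n a ->
  exists s t, twins a s t /\ size s = 1.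
Proof.
move=> le2n pa; have ua : uniq a by rewrite (perm_uniq pa) iota_uniq.
have := perm_size pa; rewrite size_iota; case: a ua {pa} => [|x [|y a]] /= ua sz; [lia|lia|].
exists [:: x], [:: y]; split=> //; split.
- by rewrite /subperm /= eqxx.
- by apply: (@subseq_trans _ (y :: a)); [rewrite /= eqxx sub0seq | apply: subseq_cons].
- by split=> // -[|i] [|j] //=; rewrite !ltnn.
move=> z; rewrite !inE => /eqP->; move: ua; rewrite inE negb_or.
by case/andP=> /andP[].
Qed.

(* length L >= n^(3/5)/8  <->  (8 L)^5 >= n^3 *)
Theorem theorem1 (n : nat) (a : seq nat) :
  2 <= n -> is_perm_of n a ->
  exists s t, twins a s t /\ n ^ 3 <= (8 * size s) ^ 5.
Proof.
move=> le2n pa.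
have [len32 | gtn32] := leqP n 32.
  have [s [t [tw sz]]] := twins_nontrivial le2n pa; exists s, t; split=> //.
  (* Length 1 suffices up to 32 because [32 ^ 3 = 8 ^ 5]. *)
  by rewrite sz -[8]/(2 ^ 3) muln1 -expnM mulnC (expnM 2 5 3) leq_exp2r.
have [p /andP[lep ltp]] := @root_floor 5 n isT.
have [le7p | ltp7] := leqP 7 p.
  have [s [t [tw le_s]]] := twins_fifth_power pa le7p lep; exists s, t; split=> //.
  apply: (@leq_trans ((p.+1 ^ 5) ^ 3)); first by rewrite leq_exp2r // ltnW.
  by rewrite -expnM mulnC expnM leq_exp2r.
have [r /andP[ler ltr]] := @root_floor 2 n isT.
have le5r : 5 <= r by rewrite leqNgt; apply/negP => ltr5; nia.
have [s [t [tw gt1s le_s]]] := twins_square pa le5r ler; exists s, t; split=> //.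
have ltr243 : r < 3 ^ 5.
  rewrite -(@ltn_exp2r _ _ 2) //; apply: leq_ltn_trans ler _.
  (* Here [p.+1 <= 7]; the weaker 9 is convenient since [9 ^ 5 = (3 ^ 5) ^ 2]. *)
  apply: leq_trans ltp _; apply: (@leq_trans (9 ^ 5)); first by rewrite leq_exp2r //; lia.
  by rewrite -[9]/(3 ^ 2) -!expnM.
(* From [n < r.+1 ^ 2] the target is [r.+1 ^ 6]; five factors [r.+1] go into [(c * r.+1) ^ 5] and
   [c ^ 5] absorbs the sixth. *)
suff [c le_c ltrc] : exists2 c, c * r.+1 <= 8 * size s & r < c ^ 5.
  apply: (@leq_trans (r.+1 ^ 6)).
    by rewrite -[6]/(2 * 3) expnM leq_exp2r // ltnW.
  apply: (@leq_trans ((c * r.+1) ^ 5)); last by rewrite leq_exp2r.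
  by rewrite expnMn expnS leq_mul.
have [ltr32 | ger32] := ltnP r (2 ^ 5); first by exists 2 => //; lia.
by exists 3 => //; move: ger32; rewrite -[2 ^ 5]/32; lia.
Qed.
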